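(* Let $0<q<1$, let $X, X_0, X_1, X_2,\ldots$ be almost surely non-negative i.i.d. random variables with $\mathbb{E}\log\max(X,1)<\infty$, and let $S=\sum_{n=0}^\infty q^n X_n$ and $M=\sup_{n\geq 0} q^n X_n$. Let $\mathbb{P}(X \leq \varepsilon) \approx \varepsilon^\beta$, as $\varepsilon\to 0$, for some $\beta>0$. Then $$-\log \mathbb{P}(M \leq \varepsilon)\sim -\log \mathbb{P}(S \leq \varepsilon) \sim \frac{\beta (\log (1/\varepsilon))^2}{2 \log (1/q)},\qquad \text{as } \varepsilon\to 0.$$
   Context: Here $\varepsilon\to 0$ means $\varepsilon\downarrow 0$ through positive values; $f\sim g$ means $\lim f/g=1$, and $f\approx g$ means $0<\liminf f/g\leq\limsup f/g<\infty$. The condition $\mathbb{E}\log\max(X,1)<\infty$ is the necessary and sufficient condition for $S<\infty$ almost surely. *)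

(* Defs.v *)
From HB Require Import structures.
From mathcomp Require Import all_boot all_order all_algebra finmap.
From mathcomp Require Import all_classical all_reals all_analysis.

Set Implicit Arguments.
Unset Strict Implicit.
Unset Printing Implicit Defensive.

Import Order.TTheory GRing.Theory Num.Theory.
Import numFieldNormedType.Exports.

Local Open Scope classical_set_scope.
Local Open Scope ring_scope.

Definition mutually_independent d (T : measurableType d) (R : realType)
    (P : probability T R) (I : choiceType) (X : I -> {RV P >-> R}) : Prop :=
  forall (J : {fset I}) (B : I -> set R),
    (forall i, i \in J -> measurable (B i)) ->
    P (\bigcap_(i in [set` J]) (X i @^-1` B i)) =
    (\prod_(i <- J) P (X i @^-1` B i))%E.

Definition identically_distributed d (T : measurableType d) (R : realType)
    (P : probability T R) (I : Type) (X : I -> {RV P >-> R}) : Prop :=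
  forall (i j : I) (B : set R), measurable B ->
    distribution P (X i) B = distribution P (X j) B.

Definition iid d (T : measurableType d) (R : realType)
    (P : probability T R) (I : choiceType) (X : I -> {RV P >-> R}) : Prop :=
  mutually_independent X /\ identically_distributed X.

(* Extended-real valued, so a divergent series of nonnegative terms is +oo.
   The library's junk value of a limit (for a series without a limit) can only
   occur at points where some term is negative. *)
Definition perpetuity (T : Type) (R : realType) (q : R) (X : nat -> T -> R)
    (w : T) : \bar R :=
  (\sum_(0 <= n <oo) (q ^+ n * X n w)%:E)%E.

Definition weighted_sup (T : Type) (R : realType) (q : R) (X : nat -> T -> R)
    (w : T) : \bar R :=
  ereal_sup (range (fun n => (q ^+ n * X n w)%:E)).

(* [ln 0 = 0] in the library; a null event thus gets the value 0, not +oo. *)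
Definition neg_log_prob d (T : measurableType d) (R : realType)
    (P : probability T R) (A : set T) : R :=
  - ln (fine (P A)).

(* Both relations are along e --> 0 with e > 0.  Since [x / 0 = 0], the ratio
   can tend to 1 only if f and g are nonzero on a right neighbourhood of 0. *)
Definition sim0 (R : realType) (f g : R -> R) : Prop :=
  f e / g e @[e --> 0^'+] --> (1 : R).

Definition approx0 (R : realType) (f g : R -> R) : Prop :=
  let r := fun e : R => (f e / g e)%:E in
  [/\ (0 < limf_einf r 0^'+)%E,
      (limf_einf r 0^'+ <= limf_esup r 0^'+)%E &
      (limf_esup r 0^'+ < +oo)%E].

(* Main.v *)
Require Import Defs.
From HB Require Import structures.
From mathcomp Require Import all_boot all_order all_algebra finmap.
From mathcomp Require Import all_classical all_reals all_analysis.
From mathcomp Require Import measurable_realfun ring lra.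

(** Write [F] for the distribution function of [X], [L = ln (1/e)] and
    [l = ln (1/q)]. The event [M <= e] is the infinite box of all
    [X_n <= e q^-n], whose probability is the product of the [F (e q^-n)]. As
    [F x] is comparable to [x^beta], each factor contributes
    [beta (L - n l) + O(1)] to the negative logarithm as long as [n < L / l], and
    the sum of this arithmetic progression is [beta L^2 / (2 l) + O(L)].
    Discarding the other factors gives a lower bound for [- ln P(M <= e)]
    ([prob_weighted_sup_le_prod], [neg_ln_prod_lower]).

    Almost surely [M <= S], so [- ln P(S <= e)] is at least [- ln P(M <= e)], and
    it remains to bound [P(S <= e)] from below. About [N = L / l] of the terms
    matter. A box with [q^n X_n <= e / (2 N)] for [n < N] and
    [X_(N+m) <= q^(-m/2)] for all [m] forces [S <= e] ([sum_threshold_le]) as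
    soon as [q^N] is a small multiple of [e]. The logarithmic moment makes the
    probability of the second family of constraints a positive constant, free of
    [N] ([tail_sum_bound], [prod_ge_expR], [prob_perpetuity_ge_prod]), while
    dividing by [2 N] in the first family costs [N beta ln (2 N)] in the
    logarithm, which is negligible against [L^2] ([neg_ln_prod_upper]).

    Both negative logarithms are thus within a relative error [O(1 / sqrt L)] of
    [beta L^2 / (2 l)], and [sim0_sandwich] concludes. *)

Set Implicit Arguments.
Unset Strict Implicit.
Unset Printing Implicit Defensive.

Import Order.TTheory GRing.Theory Num.Theory.
Import numFieldNormedType.Exports.

Local Open Scope classical_set_scope.
Local Open Scope ring_scope.

(** * Distribution functions comparable to a power *)

(** Makes the liminf and limsup of the ratio usable: both constants are finite
    and positive, also when an extended-real bound happens to be infinite. *)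
Lemma approx0_bounds (R : realType) (f g : R -> R) :
  approx0 f g -> (\forall e \near 0^'+, 0 < g e) ->
  exists c1 c2 : R, [/\ 0 < c1, 0 < c2 &
    \forall e \near 0^'+, c1 * g e <= f e <= c2 * g e].
Proof.
move=> [inf_gt0 _ sup_lty] g_gt0.
have [c1 [c1_gt0 c1f]] : exists c1 : R, 0 < c1 /\
    \forall e \near 0^'+, c1 <= f e / g e.
  move: inf_gt0; rewrite limf_einfE => /ereal_sup_gt[_ /= [V FV <-]] V_gt0.
  have [c c_gt0 cV] : exists2 c : R, 0 < c &
      (c%:E <= ereal_inf [set (f e / g e)%:E | e in V])%E.
    move: V_gt0; case: ereal_inf => [r|_|//]; last by exists 1; rewrite ?leey.
    by rewrite lte_fin => r_gt0; exists r.
  exists c; split=> //; apply: filterS FV => e Ve.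
  rewrite -lee_fin (le_trans cV)//; apply: ereal_inf_lbound.
  by exists e.
have [c2 [c2_gt0 c2f]] : exists c2 : R, 0 < c2 /\
    \forall e \near 0^'+, f e / g e <= c2.
  move: sup_lty; rewrite limf_esupE => /ereal_inf_lt[_ /= [V FV <-]] V_lty.
  have [c c_gt0 cV] : exists2 c : R, 0 < c &
      (ereal_sup [set (f e / g e)%:E | e in V] <= c%:E)%E.
    move: V_lty; case: ereal_sup => [r _|//|_]; last by exists 1; rewrite ?leNye.
    exists (Num.max r 1); first by rewrite lt_max ltr01 orbT.
    by rewrite lee_fin le_max lexx.
  exists c; split=> //; apply: filterS FV => e Ve.
  rewrite -lee_fin (le_trans _ cV)//; apply: ereal_sup_ubound.
  by exists e.
exists c1, c2; split=> //; near=> e.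
have ge0 : 0 < g e by near: e.
apply/andP; split.
  by rewrite -ler_pdivlMr//; near: e.
by rewrite -ler_pdivrMr//; near: e.
Unshelve. all: by end_near. Qed.

(** The comparison with a power is assumed only near 0, but monotonicity carries
    it further at the price of a larger constant: away from 0 the upper bound
    follows from [F <= 1], and on a bounded interval [F] stays above its value
    at a fixed small point. Having bounds free of any smallness condition
    spares the later sums over scales a case distinction. *)
Lemma log_small_ball (R : realType) (F : R -> R) (beta K : R) :
    {homo F : x y / x <= y} -> (forall x, F x <= 1) -> 0 < beta -> 0 < K ->
    approx0 F (fun e => e `^ beta) ->
  exists C : R, 0 <= C /\ forall x, 0 < x ->
    [/\ 0 < F x, ln (F x) <= beta * ln x + C &
        x <= K -> beta * ln x - C <= ln (F x)].
Proof.
move=> F_homo F_le1 beta_gt0 K_gt0 /approx0_bounds[].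
  by near=> e; rewrite powR_gt0.
move=> c1 [c2 [c1_gt0 c2_gt0]].
rewrite near_withinE /= => -[dlt /= dlt_gt0 Fdlt].
have {}Fdlt x : 0 < x -> x < dlt -> c1 * x `^ beta <= F x <= c2 * x `^ beta.
  by move=> x0 xd; apply: Fdlt => //=; rewrite sub0r normrN gtr0_norm.
have small x : 0 < x -> x < dlt ->
    [/\ 0 < F x, ln (F x) <= beta * ln x + ln c2 &
        beta * ln x + ln c1 <= ln (F x)].
  move=> x0 xd; have /andP[lo hi] := Fdlt _ x0 xd.
  have p0 := powR_gt0 beta x0.
  have F0 : 0 < F x by rewrite (lt_le_trans _ lo)// mulr_gt0.
  by split; rewrite // -ln_powR addrC -lnM ?posrE// ler_ln ?posrE// mulr_gt0.
have d2_gt0 : 0 < dlt / 2 by rewrite divr_gt0.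
have d2_lt : dlt / 2 < dlt by rewrite ltr_pdivrMr// ltr_pMr// ltr1n.
have [Fd_gt0 _ _] := small _ d2_gt0 d2_lt.
exists (`|ln c1| + `|ln c2| + `|beta * ln dlt| + `|beta * ln K - ln (F (dlt / 2))|).
split=> [|x x0]; first by rewrite !addr_ge0.
have a1 := ler_norm (- ln c1); rewrite normrN in a1.
have a2 := ler_norm (ln c2).
have a3 := ler_norm (- (beta * ln dlt)); rewrite normrN in a3.
have a4 := ler_norm (beta * ln K - ln (F (dlt / 2))).
have [b1 b2 b3 b4] : [/\ 0 <= `|ln c1|, 0 <= `|ln c2|, 0 <= `|beta * ln dlt| &
  0 <= `|beta * ln K - ln (F (dlt / 2))|] by [].
have [xd|xd] := ltP x dlt.
  by have [? ? ?] := small _ x0 xd; split=> // [|_]; lra.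
have Fx : F (dlt / 2) <= F x by apply: F_homo; lra.
have Fx0 : 0 < F x by exact: lt_le_trans Fx.
have lnxd : beta * ln dlt <= beta * ln x by rewrite ler_pM2l// ler_ln.
split=> // [|xK]; first by have := ln_le0 (F_le1 x); lra.
have : ln (F (dlt / 2)) <= ln (F x) by rewrite ler_ln.
have : beta * ln x <= beta * ln K by rewrite ler_pM2l// ler_ln.
lra.
Unshelve. all: by end_near. Qed.

(** * Asymptotics of sums over scales *)

(** Both ratios to [h] are squeezed between [1 - r] and [1 + r]; the ratio of
    [f] to [g] is then the quotient of two ratios that tend to 1. *)
Lemma sim0_sandwich (R : realType) (f g h r : R -> R) :
    (\forall e \near 0^'+, 0 < h e) ->
    (\forall e \near 0^'+,
      [/\ h e - h e * r e <= f e, f e <= g e & g e <= h e + h e * r e]) ->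
    r e @[e --> 0^'+] --> (0 : R) ->
  sim0 f g /\ sim0 g h.
Proof.
move=> h_gt0 fgh r0.
have lo : 1 - r e @[e --> 0^'+] --> (1 : R).
  by rewrite -[X in _ --> X]subr0; apply: cvgB => //; exact: cvg_cst.
have hi : 1 + r e @[e --> 0^'+] --> (1 : R).
  by rewrite -[X in _ --> X]addr0; apply: cvgD => //; exact: cvg_cst.
have fh : f e / h e @[e --> 0^'+] --> (1 : R).
  apply: squeeze_cvgr lo hi; near=> e.
  have he : 0 < h e by near: e.
  have [? ? ?] : [/\ h e - h e * r e <= f e, f e <= g e & g e <= h e + h e * r e].
    by near: e.
  by rewrite ler_pdivlMr// ler_pdivrMr//; apply/andP; split; lra.
have gh : g e / h e @[e --> 0^'+] --> (1 : R).
  apply: squeeze_cvgr lo hi; near=> e.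
  have he : 0 < h e by near: e.
  have [? ? ?] : [/\ h e - h e * r e <= f e, f e <= g e & g e <= h e + h e * r e].
    by near: e.
  by rewrite ler_pdivlMr// ler_pdivrMr//; apply/andP; split; lra.
split=> //; rewrite /sim0.
have : (f e / h e) * (g e / h e)^-1 @[e --> 0^'+] --> (1 * 1^-1 : R).
  by apply: cvgM => //; apply: cvgV => //; rewrite oner_eq0.
rewrite invr1 mulr1; apply: cvg_trans; apply: near_eq_cvg; near=> e.
have he : 0 < h e by near: e.
by rewrite /= invfM invrK mulrACA [_^-1 * _]mulrC divff ?mulr1 ?gt_eqF// mulrC.
Unshelve. all: by end_near. Qed.

Lemma ln_inv_cvgy (R : realType) : ln (1 / e) @[e --> (0 : R)^'+] --> +oo.
Proof.
apply/cvgryPgt => A; near=> e.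
rewrite div1r lnV ?posrE// ltrNr; near: e.
by move/cvgrNyPlt: (@lnNy R); apply.
Unshelve. all: by end_near. Qed.

Lemma inv_sqrt_ln_cvg0 (R : realType) (K : R) :
  K / Num.sqrt (ln (1 / e)) @[e --> (0 : R)^'+] --> (0 : R).
Proof.
apply/cvgr0Pnorm_lt => eps eps0.
have /cvgryPgt/(_ ((`|K| / eps) ^+ 2)) := @ln_inv_cvgy R.
apply: filterS => e he.
rewrite normrM normfV (ger0_norm (sqrtr_ge0 _)).
have lt0 : `|K| / eps < Num.sqrt (ln (1 / e)).
  rewrite -(ger0_norm (divr_ge0 (normr_ge0 K) (ltW eps0))) -sqrtr_sqr.
  by rewrite ltr_sqrt// (le_lt_trans (sqr_ge0 _) he).
have s0 : 0 < Num.sqrt (ln (1 / e)).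
  by apply: le_lt_trans lt0; rewrite divr_ge0// ltW.
by rewrite ltr_pdivrMr// mulrC -ltr_pdivrMr.
Qed.

Lemma sum_arith (R : realType) (a b : R) (N : nat) :
  \sum_(n < N) (a - n%:R * b) = N%:R * a - b * (N%:R ^+ 2 - N%:R) / 2.
Proof.
elim: N => [|N IH]; first by rewrite big_ord0; ring.
by rewrite big_ord_recr /= IH -natr1; field.
Qed.

(** The sum is, up to lower order, the parabola [beta (L N - l N^2 / 2)] in [N].
    Its maximum is at [N = L / l], and rounding down costs at most
    [beta l / 2]. *)
Lemma sum_small_ball_lower (R : realType) (beta C l L : R) :
    0 < beta -> 0 <= C -> 0 < l -> 0 <= L -> exists N : nat,
  beta * L ^+ 2 / (2 * l) - beta * l / 2 - C / l * L <=
  \sum_(n < N) (beta * (L - n%:R * l) - C).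
Proof.
move=> b0 C0 l0 L0.
have Ll0 : 0 <= L / l by rewrite divr_ge0// ltW.
exists (Num.truncn (L / l)).
have /andP[] := truncn_itv Ll0.
set N := Num.truncn _; rewrite -natr1 => N1 N2.
have -> : \sum_(n < N) (beta * (L - n%:R * l) - C) =
    \sum_(n < N) ((beta * L - C) - n%:R * (beta * l)).
  by apply: eq_bigr => n _; ring.
rewrite sum_arith.
have -> : beta * L ^+ 2 / (2 * l) = beta * l * (L / l) ^+ 2 / 2.
  by field; rewrite gt_eqF.
have -> : N%:R * (beta * L - C) = beta * l * (L / l) * N%:R - C * N%:R.
  by field; rewrite gt_eqF.
have -> : C / l * L = C * (L / l) by field; rewrite gt_eqF.
have CN : C * N%:R <= C * (L / l) by rewrite ler_wpM2l.
have N0 : 0 <= N%:R :> R by [].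
move: N0 N1 N2 CN Ll0; set x := L / l; set y : R := N%:R => N0 N1 N2 CN Ll0.
have bl : 0 < beta * l by rewrite mulr_gt0.
have bly : 0 <= beta * l * y by rewrite mulr_ge0// ltW.
have : beta * l * (x - y) ^+ 2 <= beta * l * 1.
  by rewrite ler_pM2l// exprn_ile1; lra.
lra.
Qed.

Lemma ln_prod (R : realType) (N : nat) (f : 'I_N -> R) :
  (forall n, 0 < f n) -> ln (\prod_(n < N) f n) = \sum_(n < N) ln (f n).
Proof.
move=> f0; suff [] : ln (\prod_(n < N) f n) = \sum_(n < N) ln (f n) /\
  0 < \prod_(n < N) f n by [].
elim/big_rec2: _ => [|n s p _ [<- p0]]; first by rewrite ln1.
by rewrite mulr_gt0// lnM ?posrE.
Qed.

(** Any bound of [ln] by a power less than 1 would do below: it only has to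
    make [L ln L] negligible against [L^2]. *)
Lemma ln_le_sqrt (R : realType) (x : R) : 0 < x -> ln x <= 2 * Num.sqrt x.
Proof.
move=> x0; have s0 : 0 < Num.sqrt x by rewrite sqrtr_gt0.
rewrite -{1}(sqr_sqrtr (ltW x0)) lnXn// mulr2n.
by have := ltW (ln_sublinear s0); lra.
Qed.

(** The parabola of the lower bound never exceeds [beta L^2 / (2 l)], whatever
    [N] is, so only the corrections matter. They amount to [N] times a constant
    plus [N ln (2 N)], and [N] is of order [L]. *)
Lemma sum_small_ball_upper (R : realType) (beta C l c k : R) :
    0 < beta -> 0 <= C -> 0 < l -> 0 <= c -> 0 <= k -> exists2 K : R, 0 <= K &
  forall (L : R) (N : nat), 1 <= L -> (0 < N)%N -> N%:R <= (L + c) / l + 1 ->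
  k + \sum_(n < N) (beta * (L - n%:R * l + ln (2 * N%:R)) + C) <=
  beta * L ^+ 2 / (2 * l) + K * (L * Num.sqrt L).
Proof.
move=> b0 C0 l0 c0 k0.
(* [D * L] bounds [N], and [E * sqrt L] bounds the correction per summand. *)
pose D := (1 + c) / l + 1.
have D0 : 0 <= D by rewrite addr_ge0// divr_ge0// ?addr_ge0// ltW.
pose E := beta * l / 2 + C + 2 * beta * Num.sqrt (2 * D).
have E0 : 0 <= E.
  have := sqrtr_ge0 (2 * D); rewrite /E => ?.
  by rewrite !addr_ge0// mulr_ge0// ?mulr_ge0// ltW.
exists (k + D * E); first by rewrite addr_ge0// mulr_ge0.
move=> L N L1 N0 NL.
have N0' : 0 < N%:R :> R by rewrite ltr0n.
have L0 : 0 < L by lra.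
have NDL : N%:R <= D * L.
  apply: le_trans NL _; rewrite [leRHS]mulrDl mul1r lerD// mulrAC ler_pM2r ?invr_gt0//.
  have cL : c * 1 <= c * L := ler_wpM2l c0 L1.
  by lra.
have t1 : 1 <= Num.sqrt L by rewrite -[leLHS]sqrtr1 ler_sqrt// ltW.
have -> : \sum_(n < N) (beta * (L - n%:R * l + ln (2 * N%:R)) + C) =
    \sum_(n < N) ((beta * L + beta * ln (2 * N%:R) + C) - n%:R * (beta * l)).
  by apply: eq_bigr => n _; ring.
rewrite sum_arith.
have lnN : ln (2 * N%:R) <= 2 * (Num.sqrt (2 * D) * Num.sqrt L).
  apply: le_trans (ln_le_sqrt _) _; first by rewrite mulr_gt0.
  rewrite ler_pM2l// -sqrtrM ?mulr_ge0// ler_sqrt ?mulr_ge0 ?(ltW L0)//.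
  by rewrite -mulrA ler_pM2l.
have -> : beta * L ^+ 2 / (2 * l) = beta * l * (L / l) ^+ 2 / 2.
  by field; rewrite gt_eqF.
have -> : N%:R * (beta * L + beta * ln (2 * N%:R) + C) =
    beta * l * (L / l) * N%:R + N%:R * (C + beta * ln (2 * N%:R)).
  by field; rewrite gt_eqF.
have err : N%:R * (beta * l / 2 + C + beta * ln (2 * N%:R)) <= D * L * (E * Num.sqrt L).
  apply: le_trans (_ : N%:R * (E * Num.sqrt L) <= _); last first.
    by rewrite ler_wpM2r// mulr_ge0// sqrtr_ge0.
  rewrite ler_pM2l// /E [leRHS]mulrDl lerD//.
    by rewrite ler_peMr// addr_ge0// mulr_ge0// ?mulr_ge0// ltW.
  by rewrite [2 * beta]mulrC -!mulrA ler_pM2l.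
have kk : k <= k * (L * Num.sqrt L) by rewrite ler_peMr// mulr_ege1.
(* The parabola stays below its vertex. *)
have : 0 <= beta * l * (L / l - N%:R) ^+ 2.
  by rewrite mulr_ge0 ?sqr_ge0// mulr_ge0// ltW.
move: err kk; set x := L / l; set y : R := N%:R; set la := ln _.
set tt := Num.sqrt L.
lra.
Qed.

(** * Events and their probabilities *)

(** No convergence is assumed. Where the sequence diverges, its limit is by
    convention a fixed default value, hence constant there; where it converges,
    the limit is the upper limit; and the set of convergence is the measurable
    set where the upper and lower limits agree. This is needed because a measure
    says nothing about its values on sets that are not measurable. *)
Lemma measurable_lim_le d (T : measurableType d) (R : realType)
    (u : nat -> T -> \bar R) (x : \bar R) :
  (forall n, measurable_fun [set: T] (u n)) ->
  measurable [set w | (limn (u ^~ w) <= x)%E].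
Proof.
move=> mu.
pose ls w := limn_esup (u ^~ w).
pose li w := limn_einf (u ^~ w).
have mls : measurable_fun [set: T] ls by exact: measurable_fun_limn_esup.
have mli : measurable_fun [set: T] li.
  rewrite (_ : li = fun w => (- limn_esup (fun n => - u n w))%E); last first.
    apply/funext => w; rewrite -[X in limn_esup X]/(-%E \o (u ^~ w)).
    by rewrite limn_esupN oppeK.
  apply: measurableT_comp => //.
  apply: measurable_fun_limn_esup => n.
  by apply: measurableT_comp; [exact: oppe_measurable|exact: mu].
have cvgE w : cvgn (u ^~ w) <-> ls w = li w.
  split=> [/[dup] /is_cvg_limn_esupE + /is_cvg_limn_einfE|].
    by rewrite /ls /li => -> ->.
  rewrite /ls /li limn_esup_lim limn_einf_lim => E.
  apply/cvg_ex; exists (limn (einfs (u ^~ w))).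
  apply: (squeeze_cvge (f := einfs (u ^~ w)) (h := esups (u ^~ w))).
  - near=> n; apply/andP; split.
      by apply: ereal_inf_lbound; exists n => /=.
    by apply: ereal_sup_ubound; exists n => /=.
  - exact: is_cvg_einfs.
  - by rewrite -E; exact: is_cvg_esups.
pose A := [set w | ls w = li w].
have mA : measurable A.
  by rewrite -[X in measurable X]setTI; apply: measurable_eqe.
rewrite (_ : [set _ | _] = (A `&` [set w | (ls w <= x)%E]) `|`
  (~` A `&` [set w : T | (point <= x)%E])); last first.
  apply/seteqP; split => w /=.
    have [Aw|Aw] := pselect (A w).
      by have /cvgE/is_cvg_limn_esupE := Aw; rewrite /ls => -> ?; left.
    move=> h; right; split=> //; move: h; rewrite dvgP//.
    by move=> /cvgE.
  move=> -[[Aw]|[Aw]].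
    by have /cvgE/is_cvg_limn_esupE := Aw; rewrite /ls => ->.
  by rewrite dvgP// => /cvgE.
apply: measurableU; apply: measurableI => //.
- by rewrite -[X in measurable X]setTI; apply: emeasurable_fun_infty_c.
- exact: measurableC.
- have [h|h] := boolP (point <= x)%E.
    by rewrite (_ : [set _ | _] = setT)//; apply/seteqP; split.
  by rewrite (_ : [set _ | _] = set0)//; apply/seteqP; split=> // w; rewrite /= (negbTE h).
Unshelve. all: by end_near. Qed.

Lemma cdfE d (T : measurableType d) (R : realType) (P : probability T R)
    (X : {RV P >-> R}) (x : R) : cdf X x = P [set w | X w <= x].
Proof.
by rewrite /cdf /distribution /pushforward; congr (P _); apply/seteqP; split=> w;
  rewrite /= in_itv.
Qed.

Lemma measurable_RV_le d (T : measurableType d) (R : realType)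
    (P : probability T R) (X : {RV P >-> R}) (x : R) :
  measurable [set w | X w <= x].
Proof.
rewrite (_ : [set w | _] = X @^-1` `]-oo, x]).
  exact: measurable_funPTI.
by apply/seteqP; split=> w; rewrite /= in_itv.
Qed.

Lemma prob_bigcap_le d (T : measurableType d) (R : realType)
    (P : probability T R) (X : {RV P >-> R}) (Xs : nat -> {RV P >-> R})
    (a : nat -> R) (N : nat) : iid (oapp Xs X) ->
  P (\bigcap_(n in `I_N) [set w | Xs n w <= a n]) = (\prod_(n < N) cdf X (a n))%E.
Proof.
move=> [indep ident].
pose B (i : option nat) : set R := if i is Some n then [set` `]-oo, a n]] else setT.
pose J := seq_fset tt (map Some (iota 0 N)).
have mB i : i \in J -> measurable (B i) by case: i => [n|] _ //=.
have memJ n : (Some n \in J) = (n < N)%N.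
  rewrite seq_fsetE; apply/mapP/idP => [[m]|nN].
    by rewrite mem_iota => /andP[_ h] [->].
  by exists n => //; rewrite mem_iota.
have := indep J B mB.
rewrite (_ : \bigcap_(i in _) _ = \bigcap_(n in `I_N) [set w | Xs n w <= a n]); last first.
  apply/seteqP; split => w h.
    move=> n /= nN; have := h (Some n); rewrite /= in_itv /=; apply.
    by rewrite memJ.
  case=> [n|] //= nJ; rewrite /= in_itv /=; apply: h.
  by rewrite /= -memJ.
move=> ->.
rewrite (perm_big _ (seq_fset_perm _ _)) undup_id; last first.
  by rewrite map_inj_uniq ?iota_uniq// => x y [].
rewrite big_map -[iota 0 N](congr1 (iota 0) (subn0 N)) -/(index_iota 0 N) big_mkord.
apply: eq_bigr => n _.
exact: (ident (Some (n : nat)) None [set` `]-oo, a n]] (measurable_itv _)).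
Qed.

Lemma le_measure_ae d (T : measurableType d) (R : realType)
    (mu : measure T R) (A B : set T) :
  measurable A -> measurable B -> {ae mu, forall w, A w -> B w} ->
  (mu A <= mu B)%E.
Proof.
move=> mA mB [N [mN N0 subN]].
have : (mu A <= mu (B `|` N))%E.
  apply: le_measure; rewrite ?inE//; first exact: measurableU.
  move=> w Aw; have [Bw|nBw] := pselect (B w); [by left|right].
  by apply: subN => /(_ Aw).
by rewrite measureU0.
Qed.

Section infinite_box.
Context d (T : measurableType d) (R : realType) (P : probability T R).
Variables (X : {RV P >-> R}) (Xs : nat -> {RV P >-> R}).
Hypothesis hiid : iid (oapp Xs X).

Let box (a : nat -> R) := [set w | forall n, Xs n w <= a n].

Lemma box_bigcap a : box a = \bigcap_n [set w | Xs n w <= a n].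
Proof. by apply/seteqP; split => w h n; [move=> _|]; apply: h. Qed.

Lemma measurable_box a : measurable (box a).
Proof.
rewrite box_bigcap; apply: bigcapT_measurable => n; exact: measurable_RV_le.
Qed.

Let mcap a N : measurable (\bigcap_(n in `I_N) [set w | Xs n w <= a n]).
Proof.
by apply: bigcap_measurableType => n _; exact: measurable_RV_le.
Qed.

Lemma prob_box_le (a : nat -> R) (N : nat) : (P (box a) <= \prod_(n < N) cdf X (a n))%E.
Proof.
rewrite -(prob_bigcap_le _ _ hiid); apply: le_measure; rewrite ?inE//.
  exact: measurable_box.
by move=> w h n _; exact: h.
Qed.

(** Bounding only the products over [N + K] factors leaves room for a box whose
    first [N] sides follow a different rule from the remaining ones. *)
Lemma prob_box_ge (a : nat -> R) (N : nat) (x : \bar R) :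
  (forall K, x <= \prod_(n < N + K) cdf X (a n))%E -> (x <= P (box a))%E.
Proof.
move=> xle; pose F M := \bigcap_(n in `I_M) [set w | Xs n w <= a n].
have -> : box a = \bigcap_M F M.
  apply/seteqP; split => w h; first by move=> M _ n _; exact: h.
  by move=> n; apply: (h n.+1 I n); rewrite /=.
have cF : P \o F @ \oo --> P (\bigcap_M F M).
  apply: nonincreasing_cvg_mu.
  - by rewrite (le_lt_trans (probability_le1 _ (mcap _ _)))// ltry.
  - by move=> M; exact: mcap.
  - by apply: bigcapT_measurable => M; exact: mcap.
  - move=> m n mn; apply/subsetPset => w h k /= km; apply: h => /=.
    exact: leq_trans km mn.
rewrite -(cvg_lim _ cF)//; apply: lime_ge; first by apply/cvg_ex; eexists; exact: cF.
near=> M; rewrite /= (prob_bigcap_le _ _ hiid).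
have -> : M = (N + (M - N))%N by rewrite subnKC//; near: M; exists N.
exact: xle.
Unshelve. all: by end_near. Qed.

End infinite_box.

(** * Positive probability of the tail constraints *)

Lemma sum_ltn_indic_le (R : realType) (y : R) (K : nat) : 0 <= y ->
  \sum_(m < K) (m%:R < y)%R%:R <= y + 1.
Proof.
move=> y0; elim: K => [|K IH]; first by rewrite big_ord0; lra.
rewrite big_ord_recr /=; have [Ky|_] := ltP K%:R y; last by rewrite addr0.
have : \sum_(m < K) ((m%:R < y)%R%:R : R) <= \sum_(m < K) 1.
  by apply: ler_sum => m _; case: (_ < _)%R.
by rewrite sumr_const card_ord -[X in _ -> _ + X <= _]/(1 : R); lra.
Qed.

(** With [Y = ln max(X, 1)], the event [X > r^-m] is [Y > m ln (1/r)]. The number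
    of such [m] is at most [Y / ln (1/r) + 1], whose expectation is finite. This
    is the only use of the logarithmic moment. *)
Lemma tail_sum_bound d (T : measurableType d) (R : realType)
    (P : probability T R) (X : {RV P >-> R}) (r : R) :
  0 < r -> r < 1 -> ('E_P[(fun w => ln (Num.max (X w) 1))%R] < +oo)%E ->
  exists B : R, forall K, \sum_(m < K) (1 - fine (cdf X (r ^- m))) <= B.
Proof.
move=> r0 r1; set Y := (fun w => _) => EY.
have rho0 : 0 < ln r^-1 by rewrite ln_gt0// invf_gt1.
have Y0 w : 0 <= Y w by rewrite ln_ge0// le_max lexx orbT.
have mY : measurable_fun setT Y.
  apply: (measurableT_comp (f := @ln R) (g := fun w => Num.max (X w) 1)) => //.
  exact: (measurable_maxr (g := cst 1)).
pose Z w := Y w / ln r^-1 + 1.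
have Z0 w : 0 <= Z w by rewrite addr_ge0// divr_ge0// ltW.
have EZ : (\int[P]_w (Z w)%:E < +oo)%E.
  rewrite /Z; under eq_integral do rewrite EFinD EFinM.
  rewrite ge0_integralD//=; last 2 first.
  - by move=> w _; rewrite -EFinM lee_fin divr_ge0// ltW.
  - by apply: emeasurable_funM => //; exact/measurable_EFinP.
  rewrite ge0_integralZr//=; last 3 first.
  - exact/measurable_EFinP.
  - by move=> w _; rewrite lee_fin.
  - by rewrite lee_fin invr_ge0 ltW.
  rewrite integral_cst//.
  have -> : (1 * P [set: T] = 1 :> \bar R)%E by rewrite probability_setT mule1.
  rewrite lte_add_pinfty ?ltry//.
  rewrite muleC lte_mul_pinfty ?lee_fin ?invr_ge0 ?(ltW rho0)//.
  by move: EY; rewrite unlock.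
have EZ0 : (0 <= \int[P]_w (Z w)%:E)%E.
  by apply: integral_ge0 => w _; rewrite lee_fin.
exists (fine (\int[P]_w (Z w)%:E)) => K.
pose A m := [set w | r ^- m < X w].
have AE m : A m = ~` [set w | X w <= r ^- m].
  by apply/seteqP; split=> w; rewrite /A /= ltNge => /negP.
have mA m : measurable (A m).
  by rewrite AE; apply: measurableC; exact: measurable_RV_le.
have PA m : (1 - fine (cdf X (r ^- m)))%:E = P (A m).
  rewrite AE probability_setC; last exact: measurable_RV_le.
  by rewrite -cdfE EFinB fineK// fin_num_measure.
rewrite -lee_fin fineK; last by rewrite ge0_fin_numE.
rewrite -sumEFin; under eq_bigr do
  rewrite PA -(setIT (A _)) -(integral_indic P measurableT (mA _)).
rewrite -ge0_integral_sum//=; last first.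
  by move=> m; apply/measurable_EFinP; exact: measurable_indic.
apply: ge0_le_integral => //=.
- by move=> w _; apply: sume_ge0 => m _; rewrite lee_fin.
- apply: emeasurable_sum => m; apply/measurable_EFinP; exact: measurable_indic.
- apply/measurable_EFinP; apply: measurable_funD => //; exact: measurable_funM.
move=> w _; rewrite sumEFin lee_fin.
have y0 : 0 <= Y w / ln r^-1 by rewrite divr_ge0// ltW.
apply: le_trans (sum_ltn_indic_le K y0); apply: ler_sum => m _.
rewrite indicE ler_nat; case: (boolP (w \in A m)) => //; rewrite inE /A /= => Aw.
suff -> : m%:R < Y w / ln r^-1 by [].
rewrite ltr_pdivlMr// mulr_natl -lnXn ?invr_gt0// exprVn /Y.
rewrite ltr_ln ?posrE ?invr_gt0 ?exprn_gt0//.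
  by rewrite lt_max Aw.
by rewrite lt_max ltr01 orbT.
Qed.

(** The elementary half of the criterion for a positive infinite product,
    factor by factor from [expR t >= 1 + t]. *)
Lemma prod_ge_expR (R : realType) (p : nat -> R) (f B : R) :
  0 < f -> (forall m, f <= p m <= 1) ->
  (forall K, \sum_(m < K) (1 - p m) <= B) ->
  forall K, expR (- (B / f)) <= \prod_(m < K) p m.
Proof.
move=> f0 fp sumB K.
have H m : expR (- ((1 - p m) / f)) <= p m.
  have /andP[fpm pm1] := fp m; have p0 : 0 < p m := lt_le_trans f0 fpm.
  rewrite expRN -[leRHS]invrK lef_pV2 ?posrE ?expR_gt0 ?invr_gt0//.
  apply: le_trans (expR_ge1Dx _).
  have : (1 - p m) / p m <= (1 - p m) / f by rewrite ler_wpM2l ?subr_ge0// lef_pV2.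
  by rewrite mulrBl mul1r divff ?gt_eqF//; lra.
apply: (@le_trans _ _ (\prod_(m < K) expR (- ((1 - p m) / f)))); last first.
  by apply: ler_prod => m _; rewrite expR_ge0 H.
rewrite -expR_sum ler_expR sumrN -mulr_suml lerN2 ler_pM2r ?invr_gt0//.
Qed.

(** * A box on which the perpetuity is small *)

Lemma geom_sum_le (R : realType) (r : R) (K : nat) : 0 <= r -> r < 1 ->
  \sum_(m < K) r ^+ m <= (1 - r)^-1.
Proof.
move=> r0 r1; have d0 : 0 < 1 - r by rewrite subr_gt0.
rewrite -[leRHS]mul1r ler_pdivlMr// mulrC -opprB mulNr -subrX1 opprB.
by rewrite gerBl exprn_ge0.
Qed.

(** Sides of the box that forces the perpetuity below [e]. The first [N] terms
    [q^n X_n] share [e / 2] equally. Beyond, the sides grow like [q^(-m/2)]: fast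
    enough for the box to keep positive probability, slowly enough for the
    weighted sum to be geometric. *)
Definition threshold (R : realType) (q e : R) (N n : nat) : R :=
  if (n < N)%N then e * q ^- n / (2 * N%:R) else Num.sqrt q ^- (n - N).

(** The condition on [q ^+ N] is what makes the geometric tail, which sums to
    [q ^+ N / (1 - sqrt q)], at most [e / 2]. *)
Lemma sum_threshold_le (R : realType) (q e : R) (N M : nat) :
  0 < q -> q < 1 -> 0 < e -> (0 < N)%N -> q ^+ N <= e * (1 - Num.sqrt q) / 2 ->
  \sum_(n < M) q ^+ n * threshold q e N n <= e.
Proof.
move=> q0 q1 e0 N0 qN; set r := Num.sqrt q in qN *.
have r0 : 0 < r by rewrite sqrtr_gt0.
have r1 : r < 1 by rewrite /r -[ltRHS]sqrtr1 ltr_sqrt.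
have d0 : 0 < 1 - r by rewrite subr_gt0.
have N0' : 0 < N%:R :> R by rewrite ltr0n.
have qr : q = r * r by rewrite -expr2 sqr_sqrtr// ltW.
have t0 n : 0 <= q ^+ n * threshold q e N n.
  rewrite mulr_ge0 ?exprn_ge0 ?(ltW q0)// /threshold; case: ifP => _.
    by rewrite divr_ge0 ?mulr_ge0 ?invr_ge0 ?exprn_ge0 ?ltW.
  by rewrite invr_ge0 exprn_ge0// ltW.
apply: (@le_trans _ _ (\sum_(n < N + M) q ^+ n * threshold q e N n)).
  rewrite addnC big_split_ord /= lerDl; apply: sumr_ge0 => n _; exact: t0.
rewrite big_split_ord /=.
have -> : \sum_(i < N) q ^+ i * threshold q e N i = e / 2.
  rewrite (eq_bigr (fun=> e / (2 * N%:R))) => [|i _].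
    by rewrite sumr_const card_ord -mulr_natr; field; rewrite gt_eqF.
  rewrite /threshold ltn_ord; field.
  by rewrite expf_neq0 ?gt_eqF.
have -> : \sum_(i < M) q ^+ (N + i) * threshold q e N (N + i) =
    q ^+ N * \sum_(i < M) r ^+ i.
  rewrite mulr_sumr; apply: eq_bigr => i _.
  rewrite /threshold ltnNge leq_addr /= addKn exprD -mulrA; congr (_ * _).
  by rewrite -/r qr exprMn mulfK// expf_neq0// gt_eqF.
have : q ^+ N * \sum_(i < M) r ^+ i <= e * (1 - r) / 2 * (1 - r)^-1.
  apply: ler_pM => //; first by rewrite exprn_ge0// ltW.
    by apply: sumr_ge0 => i _; rewrite exprn_ge0// ltW.
  by apply: geom_sum_le; rewrite // ltW.
have -> : e * (1 - r) / 2 * (1 - r)^-1 = e / 2 by field; rewrite gt_eqF.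
lra.
Qed.

Section perpetuity_bounds.
Context d (T : measurableType d) (R : realType) (P : probability T R).
Variables (q : R) (X : {RV P >-> R}) (Xs : nat -> {RV P >-> R}).
Hypotheses (q0 : 0 < q) (q1 : q < 1) (hiid : iid (oapp Xs X)).
Hypothesis Xs0 : forall n, {ae P, forall w, 0 <= Xs n w}.

Lemma weighted_sup_le_box (e : R) :
  [set w | (weighted_sup q Xs w <= e%:E)%E] =
  [set w | forall n, Xs n w <= e * q ^- n].
Proof.
have qn0 n : 0 < q ^+ n by rewrite exprn_gt0.
apply/seteqP; split => w /= h.
  move=> n; rewrite ler_pdivlMr// mulrC -lee_fin (le_trans _ h)//.
  by apply: ereal_sup_ubound; exists n.
apply: ge_ereal_sup => _ [n _ <-]; rewrite lee_fin mulrC -ler_pdivlMr//; exact: h.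
Qed.

Lemma measurable_weighted_sup_le (e : R) :
  measurable [set w | (weighted_sup q Xs w <= e%:E)%E].
Proof. rewrite weighted_sup_le_box; exact: measurable_box. Qed.

Lemma measurable_perpetuity_le (e : R) :
  measurable [set w | (perpetuity q Xs w <= e%:E)%E].
Proof.
apply: (@measurable_lim_le _ _ _
  (fun N w => \sum_(0 <= n < N) (q ^+ n * Xs n w)%:E)%E) => N.
apply: emeasurable_sum => n; apply/measurable_EFinP.
exact: measurable_funM.
Qed.

(** A sum of nonnegative terms dominates each of its terms; the terms are
    nonnegative only almost surely, so this is not an inclusion of events. *)
Lemma prob_perpetuity_le_weighted_sup (e : R) :
  (P [set w | (perpetuity q Xs w <= e%:E)%E] <=
   P [set w | (weighted_sup q Xs w <= e%:E)%E])%E.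
Proof.
apply: le_measure_ae; [exact: measurable_perpetuity_le|exact: measurable_weighted_sup_le|].
apply: filterS (ae_foralln Xs0) => w w0 /= Sw.
apply: ge_ereal_sup => _ [n _ <-]; apply: le_trans Sw.
have t0 k : (0 <= (q ^+ k * Xs k w)%:E)%E.
  by rewrite lee_fin mulr_ge0// exprn_ge0// ltW.
apply: le_trans (nneseries_lim_ge (m := 0) n.+1 _); last by move=> k _ _; exact: t0.
rewrite big_nat_recr//= leeDr//; apply: sume_ge0 => k _; exact: t0.
Qed.

Lemma prob_box_le_perpetuity (a : nat -> R) (e : R) :
  (forall M, \sum_(n < M) q ^+ n * a n <= e) ->
  (P [set w | forall n, (Xs n w <= a n)%R] <=
   P [set w | (perpetuity q Xs w <= e%:E)%E])%E.
Proof.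
move=> sa.
apply: le_measure_ae; [exact: measurable_box|exact: measurable_perpetuity_le|].
apply: filterS (ae_foralln Xs0) => w w0 /= Xa.
have t0 k : (0 <= (q ^+ k * Xs k w)%:E)%E.
  by rewrite lee_fin mulr_ge0// exprn_ge0// ltW.
rewrite /perpetuity; apply: lime_le; first by apply: is_cvg_nneseries => k _ _; exact: t0.
near=> M; rewrite big_mkord sumEFin lee_fin (le_trans _ (sa M))//.
by apply: ler_sum => n _; rewrite ler_wpM2l// exprn_ge0// ltW.
Unshelve. all: by end_near. Qed.

Let F x := fine (cdf X x).

Let prod_cdf (a : nat -> R) N :
  (\prod_(n < N) cdf X (a n))%E = (\prod_(n < N) F (a n))%:E.
Proof.
rewrite -prodEFin; apply: eq_bigr => n _.
by rewrite /F fineK// fin_num_measure.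
Qed.

Lemma prob_weighted_sup_le_prod (e : R) (N : nat) :
  fine (P [set w | (weighted_sup q Xs w <= e%:E)%E]) <=
  \prod_(n < N) F (e * q ^- n).
Proof.
rewrite -lee_fin fineK; last first.
  by rewrite fin_num_measure//; exact: measurable_weighted_sup_le.
rewrite -(prod_cdf (fun n => e * q ^- n)) weighted_sup_le_box.
exact: (prob_box_le hiid (fun n => e * q ^- n)).
Qed.

(** The constant [k] is a lower bound for the probability of all the sides of
    the box beyond the [N]-th: by identical distribution it depends neither on
    [N] nor on [e]. *)
Lemma prob_perpetuity_ge_prod :
  ('E_P[(fun w => ln (Num.max (X w) 1))%R] < +oo)%E -> 0 < F 1 ->
  exists2 k : R, 0 < k & forall (e : R) (N : nat), 0 < e -> (0 < N)%N ->
    q ^+ N <= e * (1 - Num.sqrt q) / 2 ->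
    k * \prod_(n < N) F (e * q ^- n / (2 * N%:R)) <=
    fine (P [set w | (perpetuity q Xs w <= e%:E)%E]).
Proof.
move=> EX F1.
have r0 : 0 < Num.sqrt q by rewrite sqrtr_gt0.
have r1 : Num.sqrt q < 1 by rewrite -[ltRHS]sqrtr1 ltr_sqrt.
have F_ge0 x : 0 <= F x by rewrite fine_ge0// cdf_ge0.
have [B sumB] := tail_sum_bound r0 r1 EX.
have prodB := @prod_ge_expR _ (fun m => F (Num.sqrt q ^- m)) _ _ F1 _ sumB.
exists (expR (- (B / F 1))); first exact: expR_gt0.
move=> e N e0 N0 qN.
rewrite -lee_fin fineK; last first.
  by rewrite fin_num_measure//; exact: measurable_perpetuity_le.
apply: le_trans (prob_box_le_perpetuity (fun M => sum_threshold_le M q0 q1 e0 N0 qN)).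
apply: (prob_box_ge hiid (N := N)) => K.
rewrite prod_cdf lee_fin big_split_ord /= mulrC; apply: ler_pM.
- by apply: prodr_ge0.
- exact: expR_ge0.
- by apply: ler_prod => n _; rewrite F_ge0 /threshold ltn_ord lexx.
apply: le_trans (prodB _ K) _.
  move=> m; apply/andP; split; last first.
    by rewrite -lee_fin fineK ?fin_num_measure// cdf_le1.
  rewrite fine_le ?fin_num_measure//; apply: cdf_nondecreasing.
  by rewrite invf_ge1 ?exprn_gt0// exprn_ile1// ltW.
apply: ler_prod => m _; rewrite F_ge0 /threshold.
by rewrite ltnNge leq_addr /= addKn lexx.
Qed.

End perpetuity_bounds.

(** * Logarithms of the box probabilities *)

Section product_asymptotics.
Variables (R : realType) (F : R -> R) (beta C q : R).
Hypotheses (beta0 : 0 < beta) (C0 : 0 <= C) (q0 : 0 < q) (q1 : q < 1).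
Hypothesis F0 : forall x, 0 < x -> 0 < F x.

Local Notation l := (ln (1 / q)).

Let l0 : 0 < l.
Proof. by rewrite ln_gt0// div1r invf_gt1. Qed.

Let ln_scale (e : R) (n : nat) : 0 < e ->
  ln (e * q ^- n) = n%:R * l - ln (1 / e).
Proof.
move=> e0; rewrite lnM ?posrE ?invr_gt0 ?exprn_gt0// -exprVn lnXn ?invr_gt0//.
by rewrite !div1r [ln e^-1]lnV// opprK addrC mulr_natl.
Qed.

Lemma neg_ln_prod_lower (e : R) :
    (forall x, 0 < x -> ln (F x) <= beta * ln x + C) -> 0 < e ->
    0 <= ln (1 / e) -> exists N : nat,
  beta * ln (1 / e) ^+ 2 / (2 * l) - beta * l / 2 - C / l * ln (1 / e) <=
  - ln (\prod_(n < N) F (e * q ^- n)).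
Proof.
move=> Fle e0 L0; have [N NL] := sum_small_ball_lower beta0 C0 l0 L0.
have eq0 n : 0 < e * q ^- n by rewrite divr_gt0// exprn_gt0.
exists N; apply: le_trans NL _; rewrite ln_prod => [|n]; last exact: F0.
rewrite -sumrN; apply: ler_sum => n _.
rewrite lerNr; apply: le_trans (Fle _ (eq0 n)) _.
rewrite ln_scale// le_eqVlt; apply/orP; left; apply/eqP; ring.
Qed.

Local Notation r := (Num.sqrt q).

Let r_gt0 : 0 < 1 - r.
Proof. by rewrite subr_gt0 -[ltRHS]sqrtr1 ltr_sqrt. Qed.

Let expR_rank (e : R) : 0 < e ->
  expR (ln (1 / e) + ln (2 / (1 - r))) = 2 / (e * (1 - r)).
Proof.
move=> e0; rewrite expRD !lnK ?posrE ?divr_gt0//.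
by field; rewrite !gt_eqF.
Qed.

Let expR_scale (n : nat) : q ^- n = expR (n%:R * l).
Proof.
rewrite mulr_natl div1r -lnXn ?invr_gt0// exprVn lnK//.
by rewrite posrE invr_gt0 exprn_gt0.
Qed.

(** [N] is the least natural greater than [(L + ln (2 / (1 - r))) / l], with
    [L = ln (1 / e)]. Large enough for the tail of the box to fit below [e / 2],
    it is still small enough for the first [N] sides to stay bounded as [e]
    tends to 0. *)
Lemma rank_exists (e : R) : 0 < e -> 1 <= ln (1 / e) -> exists N : nat,
  [/\ (0 < N)%N, N%:R <= (ln (1 / e) + ln (2 / (1 - r))) / l + 1,
      q ^+ N <= e * (1 - r) / 2 &
      forall n, (n < N)%N -> e * q ^- n / (2 * N%:R) <= (1 - r)^-1].
Proof.
move=> e0 L1; set y := ln _ + ln _.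
have y0 : 0 <= y.
  apply: addr_ge0; first exact: le_trans ler01 L1.
  rewrite ln_ge0// ler_pdivlMr// mul1r lerBlDr.
  by rewrite ler_wpDr ?sqrtr_ge0// ler1n.
have /andP[Ny yN] := truncn_itv (divr_ge0 y0 (ltW l0)).
pose N := (Num.truncn (y / l)).+1; exists N.
have N0 : 0 < N%:R :> R by rewrite ltr0n.
split=> //.
- by rewrite -natr1 lerD2r.
- rewrite -[leLHS]invrK -[leRHS]invrK lef_pV2 ?posrE ?invr_gt0 ?exprn_gt0 ?divr_gt0 ?mulr_gt0//.
  by rewrite expR_scale invf_div -expR_rank// ler_expR -ler_pdivrMr// ltW.
move=> n nN; apply: (@le_trans _ _ (e * expR y / (2 * N%:R))).
  rewrite ler_pM2r ?invr_gt0 ?mulr_gt0// ler_pM2l// expR_scale ler_expR.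
  by rewrite -ler_pdivlMr// (le_trans _ Ny)// ler_nat -ltnS.
rewrite expR_rank//; apply: (@le_trans _ _ ((1 - r)^-1 / N%:R)).
  rewrite le_eqVlt; apply/orP; left; apply/eqP; field.
  by rewrite !gt_eqF.
by rewrite ler_pdivrMr// ler_peMr ?invr_ge0 ?(ltW r_gt0)// ler1n.
Qed.

Lemma neg_ln_prod_upper (k : R) : 0 < k ->
    (forall x, 0 < x -> x <= (1 - r)^-1 -> beta * ln x - C <= ln (F x)) ->
  exists2 K : R, 0 <= K & forall e, 0 < e -> 1 <= ln (1 / e) ->
  exists N : nat, [/\ (0 < N)%N, q ^+ N <= e * (1 - r) / 2 &
    - ln (k * \prod_(n < N) F (e * q ^- n / (2 * N%:R))) <=
    beta * ln (1 / e) ^+ 2 / (2 * l) + K * (ln (1 / e) * Num.sqrt (ln (1 / e)))].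
Proof.
move=> k0 leF.
have c0 : 0 <= ln (2 / (1 - r)).
  rewrite ln_ge0// ler_pdivlMr// mul1r lerBlDr.
  by rewrite ler_wpDr ?sqrtr_ge0// ler1n.
have [K K0 upper] := sum_small_ball_upper beta0 C0 l0 c0 (normr_ge0 (ln k)).
exists K => // e e0 L1; have [N [N0 Nle qN thrK]] := rank_exists e0 L1.
exists N; split=> //; apply: le_trans (upper _ _ L1 N0 Nle).
have N0' : 0 < N%:R :> R by rewrite ltr0n.
have thr0 n : 0 < e * q ^- n / (2 * N%:R).
  by rewrite divr_gt0 ?mulr_gt0 ?invr_gt0 ?exprn_gt0.
rewrite lnM ?posrE//; last by apply: prodr_gt0 => n _; exact: F0.
rewrite opprD lerD//; first by rewrite -normrN ler_norm.
rewrite ln_prod => [|n]; last exact: F0.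
rewrite -sumrN; apply: ler_sum => n _.
rewrite lerNl; apply: le_trans (leF _ (thr0 n) (thrK _ (ltn_ord n))).
have lnN : ln (e * q ^- n / (2 * N%:R)) = n%:R * l - ln (1 / e) - ln (2 * N%:R).
  by rewrite ln_div ?posrE ?ln_scale// ?mulr_gt0// invr_gt0 exprn_gt0.
rewrite lnN.
rewrite le_eqVlt; apply/orP; left; apply/eqP; ring.
Qed.

End product_asymptotics.

(** * The asymptotic equivalences *)

Theorem theorem11 (d : measure_display) (T : measurableType d) (R : realType)
    (P : probability T R) (q : R) (hq0 : 0 < q) (hq1 : q < 1)
    (X : {RV P >-> R}) (Xs : nat -> {RV P >-> R})
    (hiid : iid (oapp Xs X))
    (hX0 : {ae P, forall w, 0 <= X w})
    (hXs0 : forall n, {ae P, forall w, 0 <= Xs n w})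
    (hlog : ('E_P[(fun w => ln (Num.max (X w) 1))%R] < +oo)%E)
    (beta : R) (hbeta : 0 < beta)
    (happrox : approx0 (fun e => fine (P [set w | X w <= e]))
                       (fun e => e `^ beta)) :
  let S := perpetuity q Xs in
  let M := weighted_sup q Xs in
  sim0 (fun e => neg_log_prob P [set w | (M w <= e%:E)%E])
       (fun e => neg_log_prob P [set w | (S w <= e%:E)%E]) /\
  sim0 (fun e => neg_log_prob P [set w | (S w <= e%:E)%E])
       (fun e => beta * ln (1 / e) ^+ 2 / (2 * ln (1 / q))).
Proof.
move=> S M.
set r := Num.sqrt q; set l := ln (1 / q).
have d0 : 0 < 1 - r by rewrite subr_gt0 /r -[ltRHS]sqrtr1 ltr_sqrt.
have l0 : 0 < l by rewrite ln_gt0// div1r invf_gt1.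
pose F x := fine (cdf X x).
have FE : (fun e => fine (P [set w | X w <= e])) = F.
  by apply/funext => x; rewrite /F cdfE.
rewrite FE in happrox.
have F_homo : {homo F : x y / x <= y}.
  by move=> x y xy; rewrite fine_le ?fin_num_measure//; exact: cdf_nondecreasing.
have F_le1 x : F x <= 1.
  by rewrite -lee_fin fineK ?fin_num_measure// cdf_le1.
have K0 : 0 < (1 - r)^-1 by rewrite invr_gt0.
have [C [C0 logF]] := log_small_ball F_homo F_le1 hbeta K0 happrox.
have F0 x : 0 < x -> 0 < F x by move=> /logF[].
have leF x : 0 < x -> ln (F x) <= beta * ln x + C by move=> /logF[].
have geF x : 0 < x -> x <= (1 - r)^-1 -> beta * ln x - C <= ln (F x).
  by move=> /logF[].
have [k k0 Sge] := prob_perpetuity_ge_prod hq0 hq1 hiid hXs0 hlog (F0 _ ltr01).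
have [K2 K2_ge0 upper] := neg_ln_prod_upper hbeta C0 hq0 hq1 F0 k0 geF.
have lower := neg_ln_prod_lower hbeta C0 hq0 hq1 F0 leF.
pose K1 := beta * l / 2 + C / l.
have K1_ge0 : 0 <= K1 by rewrite addr_ge0// divr_ge0// ?mulr_ge0// ltW.
(* With this [K], the relative error [K / sqrt L] of the main term
   [beta L^2 / (2 l)] is the absolute error [(K1 + K2) L sqrt L]. *)
pose K := (K1 + K2) * (2 * l) / beta.
apply: (sim0_sandwich (r := fun e => K / Num.sqrt (ln (1 / e)))); last first.
- exact: inv_sqrt_ln_cvg0.
- near=> e.
  have e0 : 0 < e by near: e; exact: nbhs_right_gt.
  have L1 : 1 <= ln (1 / e) by near: e; move/cvgryPge: (@ln_inv_cvgy R); apply.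
  have L0 : 0 <= ln (1 / e) := le_trans ler01 L1.
  have [n nlo] := lower e e0 L0.
  have [N [N0 qN Nup]] := upper e e0 L1.
  have prod0 : 0 < \prod_(n < N) F (e * q ^- n / (2 * N%:R)).
    apply: prodr_gt0 => i _; apply: F0.
    by rewrite divr_gt0 ?mulr_gt0 ?invr_gt0 ?exprn_gt0 ?ltr0n.
  have PS0 := lt_le_trans (mulr_gt0 k0 prod0) (Sge e N e0 N0 qN).
  have PSM : fine (P [set w | (S w <= e%:E)%E]) <= fine (P [set w | (M w <= e%:E)%E]).
    rewrite fine_le ?fin_num_measure//.
    - exact: measurable_perpetuity_le.
    - exact: measurable_weighted_sup_le.
    - exact: prob_perpetuity_le_weighted_sup.
  have PM0 := lt_le_trans PS0 PSM.
  have Mle := prob_weighted_sup_le_prod hq0 hiid e n.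
  have lnM : neg_log_prob P [set w | (M w <= e%:E)%E] >= - ln (\prod_(i < n) F (e * q ^- i)).
    by rewrite lerN2 ler_ln// posrE; exact: lt_le_trans Mle.
  have lnS : neg_log_prob P [set w | (S w <= e%:E)%E] <=
      - ln (k * \prod_(n < N) F (e * q ^- n / (2 * N%:R))).
    by rewrite lerN2 ler_ln ?Sge// posrE mulr_gt0.
  have {}nlo := le_trans nlo lnM; have {}Nup := le_trans lnS Nup.
  have s1 : 1 <= Num.sqrt (ln (1 / e)) by rewrite -[leLHS]sqrtr1 ler_sqrt.
  have -> : beta * ln (1 / e) ^+ 2 / (2 * l) * (K / Num.sqrt (ln (1 / e))) =
      (K1 + K2) * (ln (1 / e) * Num.sqrt (ln (1 / e))).
    (* In terms of the square root of [L] this is an identity of fractions. *)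
    rewrite /K -{1 3}(sqr_sqrtr L0).
    by field; rewrite !gt_eqF// (lt_le_trans ltr01).
  have LL : ln (1 / e) <= ln (1 / e) * Num.sqrt (ln (1 / e)) by rewrite ler_peMr.
  have LL0 := le_trans L0 LL.
  split; last 2 first.
  + by rewrite lerN2 ler_ln.
  + by apply: le_trans Nup _; rewrite lerD2l ler_wpM2r// lerDr.
  apply: le_trans nlo; rewrite -[leRHS]addrA lerD2l -opprD lerN2.
  apply: (@le_trans _ _ (K1 * (ln (1 / e) * Num.sqrt (ln (1 / e))))); last first.
    by rewrite ler_wpM2r// lerDl.
  rewrite /K1 mulrDl lerD//.
    by rewrite ler_peMr ?(le_trans L1)// divr_ge0// mulr_ge0// ltW.
  by rewrite ler_wpM2l// divr_ge0// ltW.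
- near=> e.
  have L1 : 1 <= ln (1 / e) by near: e; move/cvgryPge: (@ln_inv_cvgy R); apply.
  by rewrite divr_gt0 ?mulr_gt0 ?exprn_gt0// (lt_le_trans ltr01).
Unshelve. all: by end_near. Qed.
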